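(* Let $I\subseteq(0,\infty)$ be an interval with interior $I^\circ$, let $f:I\to\mathbb{R}$ be differentiable on $I^\circ$, and let $a,b\in I^\circ$ with $a<b$ and $f'\in L[a,b]$. Let $q\geq 1$ and $s\in(0,1]$. (a) If $|f'|^q$ is GA-$s$-convex in the second sense on $[a,b]$, then $$\left|\frac{f(a)+f(b)}{2}-\frac{1}{\ln b-\ln a}\int_a^b\frac{f(x)}{x}dx\right|\leq \ln\left(\frac ba\right)\left(\frac12\right)^{2-\frac1q}\Big[a\big\{c_1(s,q)|f'(a)|^q+c_2(s,q)|f'(b)|^q\big\}^{\frac1q}+b\big\{c_3(s,q)|f'(b)|^q+c_4(s,q)|f'(a)|^q\big\}^{\frac1q}\Big]$$ and $$\left|f(\sqrt{ab})-\frac{1}{\ln b-\ln a}\int_a^b\frac{f(x)}{x}dx\right|\leq \ln\left(\frac ba\right)\left(\frac12\right)^{3-\frac1q}\Big[a\big\{c_1(s,q/2)|f'(a)|^q+c_2(s,q/2)|f'(\sqrt{ab})|^q\big\}^{\frac1q}+b\big\{c_3(s,q/2)|f'(b)|^q+c_4(s,q/2)|f'(\sqrt{ab})|^q\big\}^{\frac1q}\Big].$$ (b) If $|f'|^q$ is GA-$s$-convex in the first sense on $[a,b]$, then $$\left|\frac{f(a)+f(b)}{2}-\frac{1}{\ln b-\ln a}\int_a^b\frac{f(x)}{x}dx\right|\leq \ln\left(\frac ba\right)\left(\frac12\right)^{2-\frac1q}\Big[a\big\{c_5(s,q)|f'(a)|^q+c_2(s,q)|f'(b)|^q\big\}^{\frac1q}+b\big\{c_6(s,q)|f'(b)|^q+c_4(s,q)|f'(a)|^q\big\}^{\frac1q}\Big]$$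 and $$\left|f(\sqrt{ab})-\frac{1}{\ln b-\ln a}\int_a^b\frac{f(x)}{x}dx\right|\leq \ln\left(\frac ba\right)\left(\frac12\right)^{3-\frac1q}\Big[a\big\{c_5(s,q/2)|f'(a)|^q+c_2(s,q/2)|f'(\sqrt{ab})|^q\big\}^{\frac1q}+b\big\{c_6(s,q/2)|f'(b)|^q+c_4(s,q/2)|f'(\sqrt{ab})|^q\big\}^{\frac1q}\Big].$$ Here, for $p>0$, $$c_1(s,p)=\int_0^1 t(1-t)^s\left(\tfrac ba\right)^{pt}dt,\quad c_2(s,p)=\int_0^1 t^{s+1}\left(\tfrac ba\right)^{pt}dt,\quad c_3(s,p)=\int_0^1 t(1-t)^s\left(\tfrac ab\right)^{pt}dt,$$ $$c_4(s,p)=\int_0^1 t^{s+1}\left(\tfrac ab\right)^{pt}dt,\quad c_5(s,p)=\int_0^1 t(1-t^s)\left(\tfrac ba\right)^{pt}dt,\quad c_6(s,p)=\int_0^1 t(1-t^s)\left(\tfrac ab\right)^{pt}dt.$$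
   Context: Let $0<s\le 1$. A function $g:J\subseteq[0,\infty)\to\mathbb{R}$ is GA-$s$-convex in the first sense on $J$ if $g(x^t y^{1-t})\leq t^s g(x)+(1-t^s)g(y)$ for all $x,y\in J$, $t\in[0,1]$; it is GA-$s$-convex in the second sense on $J$ if $g(x^t y^{1-t})\leq t^s g(x)+(1-t)^s g(y)$ for all $x,y\in J$, $t\in[0,1]$ (with $0^s=0$). $L[a,b]$ denotes the set of (Lebesgue) integrable functions on $[a,b]$. *)

(* Defs.v *)
From HB Require Import structures.
From mathcomp Require Import all_boot all_order all_algebra.
From mathcomp Require Import all_classical all_reals all_analysis.

Set Implicit Arguments.
Unset Strict Implicit.
Unset Printing Implicit Defensive.

Import Order.TTheory GRing.Theory Num.Theory.
Import numFieldNormedType.Exports.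

Local Open Scope classical_set_scope.
Local Open Scope ring_scope.

(* In the two notions below, J is meant to be an interval of [0, +oo[, so that
   the geometric mean x^t y^(1-t) of points of J lies in J, and 0 < s <= 1.
   The real power [powR] satisfies 0 `^ s = 0 for s != 0 and 0 `^ 0 = 1. *)

Definition GA_s_convex_first (R : realType) (s : R) (J : set R) (g : R -> R)
    : Prop :=
  forall x y t : R, J x -> J y -> 0 <= t <= 1 ->
    g (x `^ t * y `^ (1 - t)) <= t `^ s * g x + (1 - t `^ s) * g y.

Definition GA_s_convex_second (R : realType) (s : R) (J : set R) (g : R -> R)
    : Prop :=
  forall x y t : R, J x -> J y -> 0 <= t <= 1 ->
    g (x `^ t * y `^ (1 - t)) <= t `^ s * g x + (1 - t) `^ s * g y.

Section coefficients.
Context (R : realType).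
Implicit Types a b s p : R.
Let mu := @lebesgue_measure R.

Definition c1 a b s p : R :=
  \int[mu]_(t in `[0, 1]) (t * (1 - t) `^ s * (b / a) `^ (p * t)).

Definition c2 a b s p : R :=
  \int[mu]_(t in `[0, 1]) (t `^ (s + 1) * (b / a) `^ (p * t)).

Definition c3 a b s p : R :=
  \int[mu]_(t in `[0, 1]) (t * (1 - t) `^ s * (a / b) `^ (p * t)).

Definition c4 a b s p : R :=
  \int[mu]_(t in `[0, 1]) (t `^ (s + 1) * (a / b) `^ (p * t)).

Definition c5 a b s p : R :=
  \int[mu]_(t in `[0, 1]) (t * (1 - t `^ s) * (b / a) `^ (p * t)).

Definition c6 a b s p : R :=
  \int[mu]_(t in `[0, 1]) (t * (1 - t `^ s) * (a / b) `^ (p * t)).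

Definition log_average a b (f : R -> R) : R :=
  (ln b - ln a)^-1 * \int[mu]_(x in `[a, b]) (f x / x).

End coefficients.

(* Main.v *)
Require Import Defs.
From HB Require Import structures.
From mathcomp Require Import all_boot all_order all_algebra.
From mathcomp Require Import all_classical all_reals all_analysis.
From mathcomp Require Import ring lra.

Set Implicit Arguments.
Unset Strict Implicit.
Unset Printing Implicit Defensive.

Import Order.TTheory GRing.Theory Num.Theory.
Import numFieldNormedType.Exports.

Local Open Scope classical_set_scope.
Local Open Scope ring_scope.

(** All four inequalities come from one estimate between two points u and v
of [a, b], taken in either order.  Join u to v by the multiplicative segment
x(t) = u (v/u)^t and let Phi be a primitive of f(x)/x.  With L = ln(v/u), the
function

  F(t) = t f(x(t)) - Phi(x(t)) / L

has derivative L t x(t) f'(x(t)): the two terms in f(x(t)) cancel.  Hence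
F(1) - F(0), which is f(v) minus the logarithmic mean value of f between u
and v, should be at most |L| times the integral of t x |f'(x)| over [0, 1].
The power mean inequality for the weight t, which has mass 1/2, and the
convexity of |f'|^q along x(t) then bound it by

  |L| (1/2)^(1-1/q) u (C |f'(u)|^q + C' |f'(v)|^q)^(1/q),

where C and C' integrate t (v/u)^(qt) against the two weights of the
convexity inequality; this is [endpoint_log_mean_bound].

The estimate is proved without integrating f' at all.  Young's inequality
with a free scale c > 0 ([young_scaled]) bounds |F'| pointwise by a function
that is linear in (x |f'(x)|)^q, and after convexity by an explicit
continuous function h; comparing F with the primitive of h by the mean value
theorem ([increment_le_Rintegral]) replaces the fundamental theorem of
calculus for a derivative that need not be continuous.  Optimising c
afterwards ([le_power_mean]) recovers the power mean constant, as in the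
usual derivation of Hoelder's inequality from Young's.  Working with Phi also
makes any change of variables between x and t superfluous.

The trapezoid inequalities are half the sum of the estimates for (a, b) and
(b, a), whose logarithmic means coincide.  The midpoint ones are half the sum
of those for (a, m) and (b, m) with m the geometric mean of a and b: as
ln m - ln a = ln b - ln m = ln(b/a) / 2, the average of the two logarithmic
means is again that of [a, b], and m/a = (b/a)^(1/2) turns the exponent q of
the coefficients into q/2.  The two notions of convexity differ only in the
weight put on one point, so both are instances of [GA_weighted_bounds]. *)

(** * Integrals and primitives of continuous functions *)

Lemma continuous_integrable_itv (R : realType) (h : R -> R) (a b : R) :
  continuous h ->
  (@lebesgue_measure R).-integrable `[a, b] (EFin \o h).
Proof.
move=> ch; apply: continuous_compact_integrable; first exact: segment_compact.
exact: continuous_subspaceT.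
Qed.

Lemma continuous_lin (R : realType) (g1 g2 : R -> R) (r1 r2 : R) :
  continuous g1 -> continuous g2 -> continuous (fun t => r1 * g1 t + r2 * g2 t).
Proof.
by move=> c1 c2 t; apply: cvgD; apply: cvgMr; [exact: c1|exact: c2].
Qed.

Lemma Rintegral_lin (R : realType) (g1 g2 : R -> R) (r1 r2 a b : R) :
  continuous g1 -> continuous g2 ->
  \int[@lebesgue_measure R]_(t in `[a, b]) (r1 * g1 t + r2 * g2 t) =
  r1 * (\int[@lebesgue_measure R]_(t in `[a, b]) g1 t) +
  r2 * (\int[@lebesgue_measure R]_(t in `[a, b]) g2 t).
Proof.
move=> c1 c2.
have cZ (g : R -> R) (r : R) : continuous g -> continuous (fun t => r * g t).
  by move=> cg t; apply: cvgMr; exact: cg.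
have mab : measurable (`[a, b]%classic : set (measurableTypeR R)).
  exact: measurable_itv.
rewrite (RintegralD mab); [|exact: continuous_integrable_itv (cZ _ _ _)..].
rewrite (RintegralZl _ mab); last exact: continuous_integrable_itv.
by rewrite (RintegralZl _ mab)//; exact: continuous_integrable_itv.
Qed.

Lemma Rintegral_id01 (R : realType) :
  \int[@lebesgue_measure R]_(t in `[0, 1]) t = 1 / 2.
Proof.
have := @Rintegral_onemXn R 1.
under eq_Rintegral do rewrite expr1.
rewrite RintegralB//.
- rewrite Rintegral_cst//= lebesgue_measure_itv/= lte01 EFinN sube0/= mul1r.
  by move=> E; lra.
- by apply: (@continuous_integrable_itv R (cst 1)); exact: cst_continuous.
- by apply: (@continuous_integrable_itv R id) => x; exact: cvg_id.
Qed.

(** F + G and G - F are nondecreasing when G is a primitive of h.  The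
derivative of F is only used pointwise, so it may fail to be continuous or
integrable. *)
Lemma increment_le_Rintegral (R : realType) (F dF h : R -> R) (a b : R) :
  a < b -> continuous h ->
  (forall t, t \in `]a, b[ -> is_derive t 1 F (dF t)) ->
  {within `[a, b], continuous F} ->
  (forall t, t \in `]a, b[ -> `|dF t| <= h t) ->
  `|F b - F a| <= \int[@lebesgue_measure R]_(t in `[a, b]) h t.
Proof.
move=> ab ch FdF cF dFh.
pose G x : R := \int[@lebesgue_measure R]_(t in `[a, x]) h t.
have ih := continuous_integrable_itv a b ch.
have cG : {within `[a, b], continuous G}.
  exact: (parameterized_integral_continuous (ltW ab) ih).
have GdG t : t \in `]a, b[ -> is_derive t 1 G (h t).
  rewrite in_itv/= => /andP[at_ tb].
  have [dG G'] := continuous_FTC1_closed tb ih at_ (ch t).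
  by split; [exact: dG|rewrite -derive1E; exact: G'].
have Ga : G a = 0 by rewrite /G set_itv1 Rintegral_set1.
rewrite -/(G b) -[G b]subr0 -Ga ler_norml; apply/andP; split.
- have [||c cab] := @MVT _ (F \+ G) (dF \+ h) a b ab.
  + by move=> t tab; apply: is_deriveD; [exact: FdF|exact: GdG].
  + by move=> x; apply: continuousD; [exact: cF|exact: cG].
  rewrite /= => E.
  have : 0 <= (dF c + h c) * (b - a).
    have := dFh c cab; rewrite ler_norml => /andP[? ?].
    by apply: mulr_ge0; lra.
  by rewrite -E; lra.
- have [||c cab] := @MVT _ (G - F) (h - dF) a b ab.
  + by move=> t tab; apply: is_deriveB; [exact: GdG|exact: FdF].
  + by move=> x; apply: continuousB; [exact: cG|exact: cF].
  rewrite /= => E.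
  have : 0 <= (h c - dF c) * (b - a).
    have := dFh c cab; rewrite ler_norml => /andP[? ?].
    by apply: mulr_ge0; lra.
  by rewrite -[h c - dF c]/((h - dF) c) -E !fctE; lra.
Qed.

(** Starting the integral strictly to the left of a, inside U, makes the
primitive differentiable on both sides at the end points a and b. *)
Lemma exists_primitive (R : realType) (U : set R) (g : R -> R) (a b : R) :
  is_interval U -> open U -> U a -> U b -> a < b ->
  (forall x, U x -> {for x, continuous g}) ->
  exists2 G : R -> R, (forall x, x \in `[a, b] -> is_derive x 1 G (g x)) &
    G b - G a = \int[@lebesgue_measure R]_(x in `[a, b]) g x.
Proof.
move=> iU oU Ua Ub ab cg.
have [e /= e0 Be] : nbhs_ball a U by apply/nbhs_ballP; exact: oU.
have [d /= d0 Bd] : nbhs_ball b U by apply/nbhs_ballP; exact: oU.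
pose a' := a - e / 2; pose b' := b + d / 2.
have Ua' : U a'.
  by apply: Be; rewrite /ball/= /a' opprB addrC subrK gtr0_norm; lra.
have Ub' : U b'.
  by apply: Bd; rewrite /ball/= /b' opprD addrA subrr sub0r normrN gtr0_norm; lra.
have aa : a' < a by rewrite /a'; lra.
have bb : b < b' by rewrite /b'; lra.
have ig x y : a' <= x -> y <= b' ->
    (@lebesgue_measure R).-integrable `[x, y] (EFin \o g).
  move=> xx yy; apply: continuous_compact_integrable; first exact: segment_compact.
  apply/continuous_in_subspaceT => z; rewrite inE/= in_itv/= => /andP[xz zy].
  by apply: cg; apply: (iU a' b') => //; apply/andP; split; lra.
exists (fun x => \int[@lebesgue_measure R]_(t in `[a', x]) g t).
- move=> x; rewrite in_itv/= => /andP[ax xb].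
  have [||||dG G'] := @continuous_FTC1_closed _ g a' x b'.
  + by lra.
  + exact: ig.
  + by lra.
  + by apply: cg; apply: (iU a b) => //; apply/andP.
  by split; [exact: dG|rewrite -derive1E; exact: G'].
- rewrite Rintegral_itvB ?bnd_simp; try lra.
  + rewrite Rintegral_itv_obnd_cbnd//.
    apply: integrableS (ig a b (ltW aa) (ltW bb)) => //.
    exact: subset_itv_oc_cc.
  + by apply: ig; lra.
Qed.

(** * Power means through Young's inequality *)

(** Young's inequality for z c^(1/q-1) and c^(1-1/q).  It is an equality at
z = c, so no sharpness is lost if c is chosen afterwards. *)
Lemma young_scaled (R : realType) (q c z : R) :
  1 <= q -> 0 < c -> 0 <= z ->
  z <= c * (1 - 1 / q) + c `^ (1 - q) * z `^ q / q.
Proof.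
move=> q1 c0 z0.
have q0 : 0 < q by lra.
(* The conjugate exponent of q = 1 is infinite. *)
have [<-|qn1] := eqVneq 1 q.
  by rewrite divr1 subrr mulr0 add0r powRr0 mul1r powRr1 ?divr1.
have q11 : 0 < 1 - 1 / q by rewrite subr_gt0 div1r invf_lt1// lt_neqAle qn1.
have := @conjugate_powR R (z * c `^ (1 / q - 1)) (c `^ (1 - 1 / q))
  q (1 - 1 / q)^-1.
move=> /(_ (mulr_ge0 z0 (powR_ge0 _ _)) (powR_ge0 _ _) q0).
rewrite invr_gt0 => /(_ q11); rewrite invrK.
move=> /(_ ltac:(by rewrite div1r addrC subrK)).
rewrite -mulrA -powRD; last by rewrite (gt_eqF c0) implybT.
have -> : 1 / q - 1 + (1 - 1 / q) = 0 by ring.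
rewrite powRr0 mulr1 powRM ?powR_ge0// -!powRrM (divff (lt0r_neq0 q11)).
rewrite (powRr1 (ltW c0)).
have -> : (1 / q - 1) * q = 1 - q by field; rewrite gt_eqF.
by move=> /le_trans; apply; rewrite addrC (mulrC (z `^ q)).
Qed.

(** The hypothesis is what [young_scaled] gives after integration against a
weight of mass 1/2 when A is the integral of the q-th power. *)
Lemma le_power_mean (R : realType) (q A D : R) :
  1 <= q -> 0 <= A ->
  (forall c : R, 0 < c -> D <= c * (1 - 1 / q) / 2 + c `^ (1 - q) * A / q) ->
  D <= (1 / 2) `^ (1 - 1 / q) * A `^ (1 / q).
Proof.
move=> q1 A0 Dc.
have q0 : 0 < q by lra.
have qi0 : 0 < 1 / q by rewrite div1r invr_gt0.
move: A0; rewrite le_eqVlt => /predU1P[A0|A0].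
  (* The scale chosen below would be 0; let c tend to 0 instead. *)
  rewrite -A0 powR0 ?gt_eqF// mulr0; apply/ler_addgt0Pl => e e0.
  have := Dc e e0; rewrite -A0 mulr0 mul0r addr0.
  have : 0 <= e * (1 / q) by apply: mulr_ge0; lra.
  by lra.
have A20 : 0 < 2 * A by lra.
(* The mean value of the q-th power is 2 A, and c is its q-th root. *)
have := Dc ((2 * A) `^ (1 / q)) (powR_gt0 _ A20).
rewrite -powRrM.
have -> : 1 / q * (1 - q) = 1 / q - 1 by field; rewrite gt_eqF.
rewrite [_ `^ (1 / q - 1)]powRD; last by rewrite (gt_eqF A20) implybT.
rewrite powRN (powRr1 (ltW A20)).
move=> /le_trans; apply.
rewrite [X in _ <= X](_ : _ = (2 * A) `^ (1 / q) / 2); last first.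
  rewrite powRM ?(ltW A0)// powRD; last by apply/implyP => _; apply/eqP; lra.
  rewrite powRr1; last lra.
  have -> : (1 / 2 : R) `^ (- (1 / q)) = 2 `^ (1 / q).
    by rewrite (div1r 2) -[2^-1]powR_inv1// -powRrM mulrNN !mul1r.
  by ring.
rewrite le_eqVlt; apply/orP; left; apply/eqP; field.
by rewrite !gt_eqF.
Qed.

(** * The coefficients *)

(** The real power takes the value 1 at negative numbers, hence jumps at 0.
Taking the absolute value of the base gives weights that agree with the
expected ones on [0, 1] and are continuous on the whole line. *)
Lemma continuous_norm_powR (R : realType) (s : R) : 0 < s ->
  continuous (fun t : R => `|t| `^ s).
Proof.
move=> s0 t; have [->|t0] := eqVneq t 0; last first.
  apply: (@continuous_comp _ _ _ (fun t : R => `|t|) (fun t => t `^ s)).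
    exact: norm_continuous.
  have /derivable1_diffP/differentiable_continuous :
      derivable (fun t => t `^ s) `|t| 1.
    by apply: derivable_powR; rewrite in_itv/= normr_gt0 t0.
  exact.
rewrite /prop_for/continuous_at normr0 powR0 ?gt_eqF//.
apply/cvgrPdist_lt => e e0; near=> x.
rewrite sub0r normrN ger0_norm ?powR_ge0//.
rewrite -[ltRHS](powRr1 (ltW e0)) -(mulVf (lt0r_neq0 s0)) powRrM.
apply: gt0_ltr_powR => //; rewrite ?nnegrE ?powR_ge0//.
near: x; exists (e `^ s^-1) => /=; first exact: powR_gt0.
by move=> y /=; rewrite sub0r normrN.
Unshelve. all: by end_near. Qed.

(** Common form of the six coefficients: w is the weight of one of the two
points in the convexity inequality, r the ratio of the points. *)
Definition moment (R : realType) (w : R -> R) (r p : R) : R :=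
  \int[@lebesgue_measure R]_(t in `[0, 1]) (t * w t * r `^ (p * t)).

Lemma moment_ge0 (R : realType) (w : R -> R) (r p : R) :
  (forall t : R, 0 <= t <= 1 -> 0 <= w t) -> 0 <= moment w r p.
Proof.
move=> w0; apply: Rintegral_ge0 => t /=; rewrite in_itv/= => t01.
by rewrite !mulr_ge0 ?w0 ?powR_ge0//; case/andP: t01.
Qed.

Lemma eq_moment (R : realType) (w w' : R -> R) (r p : R) :
  (forall t : R, 0 <= t <= 1 -> w t = w' t) -> moment w r p = moment w' r p.
Proof.
move=> ww; apply: eq_Rintegral => t; rewrite inE/= in_itv/= => t01.
by rewrite ww.
Qed.

Lemma moment_powR (R : realType) (w : R -> R) (r d p : R) :
  moment w (r `^ d) p = moment w r (d * p).
Proof.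
by apply: eq_Rintegral => t _; rewrite -powRrM mulrA.
Qed.

(** * Multiplicative segments *)

(** The multiplicative segment u (v/u)^t, written so that its logarithm is
visibly affine in t. *)
Definition geodesic (R : realType) (u v t : R) : R :=
  expR (ln u + t * (ln v - ln u)).

Lemma geodesicE (R : realType) (u v t : R) : 0 < u -> 0 < v ->
  v `^ t * u `^ (1 - t) = geodesic u v t.
Proof.
move=> u0 v0; rewrite /powR !gt_eqF// -expRD /geodesic; congr expR; ring.
Qed.

Lemma geodesic0 (R : realType) (u v : R) : 0 < u -> geodesic u v 0 = u.
Proof. by move=> u0; rewrite /geodesic mul0r addr0 lnK. Qed.

Lemma geodesic1 (R : realType) (u v : R) : 0 < v -> geodesic u v 1 = v.
Proof. by move=> u0; rewrite /geodesic mul1r addrC subrK lnK. Qed.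

Lemma geodesic_powR (R : realType) (u v q t : R) : 0 < u -> 0 < v ->
  geodesic u v t `^ q = u `^ q * (v / u) `^ (q * t).
Proof.
move=> u0 v0; have r0 : 0 < v / u by exact: divr_gt0.
rewrite /powR !gt_eqF ?expR_gt0// expRK -expRD ln_div//; congr expR; ring.
Qed.

Lemma geodesic_itv (R : realType) (a b u v t : R) : 0 < a ->
  u \in `[a, b] -> v \in `[a, b] -> 0 <= t <= 1 ->
  geodesic u v t \in `[a, b].
Proof.
move=> a0; rewrite !in_itv/= => /andP[au ub] /andP[av vb] /andP[t0 t1].
have u0 : 0 < u by lra.
have v0 : 0 < v by lra.
have b0 : 0 < b by lra.
have E : ln u + t * (ln v - ln u) = (1 - t) * ln u + t * ln v by ring.
rewrite /geodesic E.
have lau : ln a <= ln u by rewrite ler_ln.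
have lav : ln a <= ln v by rewrite ler_ln.
have lub : ln u <= ln b by rewrite ler_ln.
have lvb : ln v <= ln b by rewrite ler_ln.
apply/andP; split.
- by rewrite -[leLHS](lnK (a0 : a \is Num.pos)) ler_expR; nra.
- by rewrite -[leRHS](lnK (b0 : b \is Num.pos)) ler_expR; nra.
Qed.

Lemma is_derive_geodesic (R : realType) (u v t : R) :
  is_derive t 1 (geodesic u v) (geodesic u v t * (ln v - ln u)).
Proof.
set L := ln v - ln u.
have dl : is_derive t 1 (fun t => ln u + t * L) L.
  apply: is_derive_eq; rewrite scaler0 !add0r.
  by rewrite mul1r; exact: mulr1.
exact: (@is_derive1_comp R expR (fun t => ln u + t * L) t _ _
  (is_derive_expR _) dl).
Qed.

(** * The estimate between two points *)

(** The quotient on the left is the mean value of f for the measure dx/x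
between u and v; u may lie on either side of v, which covers the two
halves of each inequality at once. *)
Lemma endpoint_log_mean_bound (R : realType) (f df Phi w1 w2 : R -> R)
    (a b u v q : R) :
  0 < a -> u \in `[a, b] -> v \in `[a, b] -> u != v -> 1 <= q ->
  continuous w1 -> continuous w2 ->
  (forall t : R, 0 <= t <= 1 -> 0 <= w1 t) ->
  (forall t : R, 0 <= t <= 1 -> 0 <= w2 t) ->
  (forall x, x \in `[a, b] -> is_derive x 1 f (df x)) ->
  (forall x, x \in `[a, b] -> is_derive x 1 Phi (f x / x)) ->
  (forall t : R, 0 <= t <= 1 -> `|df (v `^ t * u `^ (1 - t))| `^ q <=
     w2 t * `|df v| `^ q + w1 t * `|df u| `^ q) ->
  `|f v - (Phi v - Phi u) / (ln v - ln u)| <=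
    `|ln v - ln u| * (1 / 2) `^ (1 - 1 / q) *
    (u * (moment w1 (v / u) q * `|df u| `^ q
          + moment w2 (v / u) q * `|df v| `^ q) `^ (1 / q)).
Proof.
move=> a0 uab vab uv q1 cw1 cw2 w10 w20 fdf Phif conv.
have q0 : 0 < q by lra.
have u0 : 0 < u by move: uab; rewrite in_itv/= => /andP[+ _]; lra.
have v0 : 0 < v by move: vab; rewrite in_itv/= => /andP[+ _]; lra.
have r0 : 0 < v / u by exact: divr_gt0.
set L := ln v - ln u.
have L0 : L != 0.
  by rewrite subr_eq0; apply: contra_neq uv => /ln_inj-> //; rewrite posrE.
set M1 := moment w1 (v / u) q; set M2 := moment w2 (v / u) q.
set gu := `|df u| `^ q; set gv := `|df v| `^ q.
have gu0 : 0 <= gu by exact: powR_ge0.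
have gv0 : 0 <= gv by exact: powR_ge0.
have M10 : 0 <= M1 by exact: moment_ge0.
have M20 : 0 <= M2 by exact: moment_ge0.
have S0 : 0 <= M1 * gu + M2 * gv by rewrite addr_ge0// mulr_ge0.
pose x := geodesic u v.
have xab (t : R) : 0 <= t <= 1 -> x t \in `[a, b] by exact: geodesic_itv.
have x0 t : 0 < x t by exact: expR_gt0.
(* The factor 1/L makes the term f (x t) in the derivative of t * f (x t)
   cancel against the derivative of Phi along the segment. *)
pose F t := t * f (x t) - L^-1 * Phi (x t).
have FdF (t : R) : 0 <= t <= 1 -> is_derive t 1 F (L * (t * (x t * df (x t)))).
  move=> t01.
  have dx := is_derive_geodesic u v t.
  have df' := @is_derive1_comp R f x t _ _ (fdf _ (xab _ t01)) dx.
  have dPhi := @is_derive1_comp R Phi x t _ _ (Phif _ (xab _ t01)) dx.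
  rewrite /F.
  have := is_deriveB (is_deriveM (is_derive_id t 1) df')
     (is_deriveM (is_derive_cst L^-1 t 1) dPhi).
  move/is_derive_eq; apply.
  rewrite /GRing.scale/= -/L -/(x t); field.
  by rewrite L0 gt_eqF.
rewrite -mulrA -ler_pdivrMl ?normr_gt0//.
have -> : u * (M1 * gu + M2 * gv) `^ (1 / q) =
   (u `^ q * (M1 * gu + M2 * gv)) `^ (1 / q).
  by rewrite powRM ?powR_ge0// -powRrM (mulrC q) divfK ?gt_eqF// powRr1 ?ltW.
apply: le_power_mean => //; first by rewrite mulr_ge0 ?powR_ge0.
move=> c c0.
rewrite ler_pdivrMl ?normr_gt0//.
(* |L| t times the bound of [young_scaled] for x |f'(x)|, in which convexity
   has replaced |f'(x)|^q and x^q = u^q (v/u)^(qt). *)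
pose k := c `^ (1 - q) / q * u `^ q.
pose h (t : R) : R := `|L| * (c * (1 - 1 / q)) * t + `|L| * k *
   (gu * (t * w1 t * (v / u) `^ (q * t)) + gv * (t * w2 t * (v / u) `^ (q * t))).
have ch1 (w : R -> R) : continuous w ->
    continuous (fun t : R => t * w t * (v / u) `^ (q * t)).
  move=> cw t; apply: cvgM; first by apply: cvgM; [exact: cvg_id|exact: cw].
  rewrite /powR gt_eqF//.
  apply: (@continuous_comp _ _ _ (fun t : R => q * t * ln (v / u)) expR).
    by apply: cvgMl; apply: cvgMr; exact: cvg_id.
  exact: continuous_expR.
have ch : continuous h.
  apply: continuous_lin; first by move=> t; exact: cvg_id.
  by apply: continuous_lin; exact: ch1.
have := @increment_le_Rintegral R F _ h 0 1 ltr01 ch.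
have int_h : \int[@lebesgue_measure R]_(t in `[0, 1]) h t =
    `|L| * (c * (1 - 1 / q) * (1 / 2) + k * (gu * M1 + gv * M2)).
  have cid : continuous (fun t : R => t) by move=> t; exact: cvg_id.
  have cW := @continuous_lin R _ _ gu gv (ch1 _ cw1) (ch1 _ cw2).
  rewrite (@Rintegral_lin R _ _ _ _ _ _ cid cW).
  rewrite (@Rintegral_lin R _ _ _ _ _ _ (ch1 _ cw1) (ch1 _ cw2)).
  rewrite Rintegral_id01 -/(moment w1 _ _) -/(moment w2 _ _) -/M1 -/M2.
  ring.
rewrite int_h.
have -> : F 1 - F 0 = f v - (Phi v - Phi u) / L.
  by rewrite /F /x geodesic0// geodesic1//; ring.
set dF := fun t : R => L * (t * (x t * df (x t))).
have FdF01 (t : R) : t \in `]0, 1[ -> is_derive t 1 F (dF t).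
  by rewrite in_itv/= => /andP[? ?]; apply: FdF; apply/andP; split; lra.
have cF : {within `[0, 1], continuous F}.
  apply: continuous_in_subspaceT => t; rewrite inE/= in_itv/= => t01.
  by have [/derivable1_diffP/differentiable_continuous] := FdF t t01.
have dFh (t : R) : t \in `]0, 1[ -> `|dF t| <= h t.
  rewrite in_itv/= => /andP[t0 t1].
  have t01 : 0 <= t <= 1 by apply/andP; split; lra.
  rewrite normrM (_ : h t = `|L| * (c * (1 - 1 / q) * t + k *
    (gu * (t * w1 t * (v / u) `^ (q * t))
     + gv * (t * w2 t * (v / u) `^ (q * t))))); last by rewrite /h; ring.
  rewrite ler_pM2l ?normr_gt0// normrM ger0_norm ?(ltW t0)//.
  rewrite normrM gtr0_norm//.
  have K : (x t * `|df (x t)|) `^ q <=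
     u `^ q * (v / u) `^ (q * t) * (w2 t * gv + w1 t * gu).
    rewrite powRM ?(ltW (x0 t))// /x geodesic_powR//.
    rewrite ler_wpM2l ?mulr_ge0 ?powR_ge0//.
    by rewrite -geodesicE//; exact: conv.
  have Y := young_scaled q1 c0 (mulr_ge0 (ltW (x0 t)) (normr_ge0 (df (x t)))).
  have : c `^ (1 - q) / q * (x t * `|df (x t)|) `^ q <= k *
     ((v / u) `^ (q * t) * (w2 t * gv + w1 t * gu)).
    have cq0 : 0 <= c `^ (1 - q) / q by rewrite divr_ge0 ?powR_ge0 ?ltW.
    by apply: (le_trans (ler_wpM2l cq0 K)); rewrite /k !mulrA.
  move=> K2.
  have : x t * `|df (x t)| <= c * (1 - 1 / q) + k *
     ((v / u) `^ (q * t) * (w2 t * gv + w1 t * gu)).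
    by apply: (le_trans Y); rewrite lerD2l mulrAC.
  move=> /(ler_wpM2l (ltW t0)) /le_trans; apply.
  by rewrite le_eqVlt; apply/orP; left; apply/eqP; ring.
move=> /(_ dF FdF01 cF dFh) le_inc; apply: (le_trans le_inc).
rewrite ler_pM2l ?normr_gt0// le_eqVlt; apply/orP; left; apply/eqP.
  by rewrite /k; ring.
Qed.

(** * Trapezoid and midpoint inequalities *)

Definition GA_weighted_convex (R : realType) (w1 w2 : R -> R) (J : set R)
    (g : R -> R) : Prop :=
  forall x y t : R, J x -> J y -> 0 <= t <= 1 ->
    g (x `^ t * y `^ (1 - t)) <= w2 t * g x + w1 t * g y.

Lemma is_interval_interior (R : realType) (I : set R) :
  is_interval I -> is_interval (interior I).
Proof.
move=> iI x y Ix Iy z /andP[].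
rewrite le_eqVlt => /predU1P[<-//|xz]; rewrite le_eqVlt => /predU1P[->//|zy].
have : nbhs z `]x, y[%classic by apply: near_in_itvoo; rewrite in_itv/= xz.
apply: filterS => t /=; rewrite in_itv/= => /andP[xt ty].
by apply: (iI x y); [exact: interior_subset|exact: interior_subset|rewrite !ltW].
Qed.

Lemma powR_halfD1 (R : realType) (d : R) :
  (1 / 2) `^ (1 + d) = 1 / 2 * (1 / 2) `^ d :> R.
Proof.
rewrite powRD; last by apply/implyP => _; apply/eqP; lra.
by rewrite powRr1//; lra.
Qed.

Lemma half_sum_bound (R : realType) (q L S T X Y : R) :
  `|X| <= L * (1 / 2) `^ (1 - 1 / q) * S ->
  `|Y| <= L * (1 / 2) `^ (1 - 1 / q) * T ->
  `|(X + Y) / 2| <= L * (1 / 2) `^ (2 - 1 / q) * (S + T).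
Proof.
move=> XS YT.
have -> : (1 / 2 : R) `^ (2 - 1 / q) = 1 / 2 * (1 / 2) `^ (1 - 1 / q).
  by rewrite -powR_halfD1; congr powR; ring.
rewrite normrM (@ger0_norm _ 2^-1) ?invr_ge0//.
by have := ler_normD X Y; nra.
Qed.

(** Any pair of continuous nonnegative weights will do: the estimate between
two points only integrates the convexity inequality. *)
Lemma GA_weighted_bounds (R : realType) (I : set R) (f w1 w2 : R -> R)
    (a b q : R) :
  is_interval I -> I `<=` `]0, +oo[ ->
  (forall x : R, interior I x -> derivable f x 1) ->
  interior I a -> interior I b -> a < b -> 1 <= q ->
  continuous w1 -> continuous w2 ->
  (forall t : R, 0 <= t <= 1 -> 0 <= w1 t) ->
  (forall t : R, 0 <= t <= 1 -> 0 <= w2 t) ->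
  GA_weighted_convex w1 w2 `[a, b] (fun x => `|derive1 f x| `^ q) ->
  `|(f a + f b) / 2 - log_average a b f| <=
    ln (b / a) * (1 / 2) `^ (2 - 1 / q) *
    (a * (moment w1 (b / a) q * `|derive1 f a| `^ q
          + moment w2 (b / a) q * `|derive1 f b| `^ q) `^ (1 / q)
     + b * (moment w1 (a / b) q * `|derive1 f b| `^ q
          + moment w2 (a / b) q * `|derive1 f a| `^ q) `^ (1 / q))
  /\
  `|f (Num.sqrt (a * b)) - log_average a b f| <=
    ln (b / a) * (1 / 2) `^ (3 - 1 / q) *
    (a * (moment w1 (b / a) (q / 2) * `|derive1 f a| `^ q
          + moment w2 (b / a) (q / 2) * `|derive1 f (Num.sqrt (a * b))| `^ q)
          `^ (1 / q)
     + b * (moment w1 (a / b) (q / 2) * `|derive1 f b| `^ q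
          + moment w2 (a / b) (q / 2) * `|derive1 f (Num.sqrt (a * b))| `^ q)
          `^ (1 / q)).
Proof.
move=> iI Ipos fd aI bI ab q1 cw1 cw2 w10 w20 conv.
have pos x : interior I x -> 0 < x.
  by move=> /interior_subset/Ipos/=; rewrite in_itv/= andbT.
have a0 := pos _ aI; have b0 := pos _ bI.
have abI x : x \in `[a, b] -> interior I x.
  by rewrite in_itv/= => ?; exact: (is_interval_interior iI aI bI).
have [x Ix|Phi dPhi PhiE] := exists_primitive (g := fun x => f x / x)
    (is_interval_interior iI) (open_interior I) aI bI ab.
  apply: cvgM; first exact/differentiable_continuous/derivable1_diffP/fd.
  by apply: cvgV; [rewrite gt_eqF// pos|exact: cvg_id].
have df x : x \in `[a, b] -> is_derive x 1 f (derive1 f x).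
  by move=> xab; rewrite derive1E; apply: derivableP; exact/fd/abI.
have bound u v : u \in `[a, b] -> v \in `[a, b] -> u != v ->
    `|f v - (Phi v - Phi u) / (ln v - ln u)| <=
    `|ln v - ln u| * (1 / 2) `^ (1 - 1 / q) *
    (u * (moment w1 (v / u) q * `|derive1 f u| `^ q
          + moment w2 (v / u) q * `|derive1 f v| `^ q) `^ (1 / q)).
  move=> uab vab uv.
  apply: (endpoint_log_mean_bound a0 uab vab uv q1 cw1 cw2 w10 w20 df dPhi).
  by move=> t t01; exact: (conv v u t vab uab t01).
have avgE : log_average a b f = (Phi b - Phi a) / (ln b - ln a).
  by rewrite /log_average -PhiE mulrC.
have lab : 0 < ln b - ln a by rewrite subr_gt0 ltr_ln.
have LE : ln (b / a) = ln b - ln a by rewrite ln_div.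
have aab : a \in `[a, b] by rewrite in_itv/= lexx ltW.
have bab : b \in `[a, b] by rewrite in_itv/= lexx ltW.
have anb : a != b by rewrite lt_eqF.
split.
  have := bound b a bab aab; rewrite eq_sym => /(_ anb) Ba.
  have Bb := bound a b aab bab anb.
  rewrite (distrC (ln a) (ln b)) (gtr0_norm lab) in Ba.
  rewrite (gtr0_norm lab) in Bb.
  rewrite LE avgE.
  rewrite [X in `|X|](_ : _ = ((f b - (Phi b - Phi a) / (ln b - ln a)) +
     (f a - (Phi a - Phi b) / (ln a - ln b))) / 2).
    exact: (half_sum_bound Bb Ba).
  rewrite -(opprB (ln b) (ln a)).
  move: (lt0r_neq0 lab); set d := ln b - ln a => d0; by field.
set m := Num.sqrt (a * b).
have m0 : 0 < m by rewrite sqrtr_gt0 mulr_gt0.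
have lnm : ln m = (ln a + ln b) / 2.
  rewrite /m -powR12_sqrt ?mulr_ge0 ?ltW// ln_powR lnM//; ring.
have lma : ln m - ln a = (ln b - ln a) / 2 by rewrite lnm; field.
have lmb : ln m - ln b = - ((ln b - ln a) / 2) by rewrite lnm; field.
have am : a < m by rewrite -ltr_ln//; lra.
have mb : m < b by rewrite -ltr_ln//; lra.
have mab : m \in `[a, b] by rewrite in_itv/= !ltW.
have ma : m / a = (b / a) `^ 2^-1.
  apply: ln_inj; rewrite ?posrE ?powR_gt0 ?divr_gt0//.
  by rewrite ln_powR !ln_div// lma mulrC.
have mbE : m / b = (a / b) `^ 2^-1.
  apply: ln_inj; rewrite ?posrE ?powR_gt0 ?divr_gt0// ln_powR !ln_div// lmb.
  by field.
(* Both estimates end at m, so their errors f m - mean add up to twice the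
   midpoint error. *)
have := bound a m aab mab; rewrite (lt_eqF am) => /(_ isT) Ba.
have := bound b m bab mab; rewrite (gt_eqF mb) => /(_ isT) Bb.
move: Ba Bb; rewrite ma mbE !moment_powR (mulrC 2^-1 q) lma lmb normrN.
have l20 : 0 < (ln b - ln a) / 2 by lra.
rewrite (gtr0_norm l20).
move=> Ba Bb.
rewrite LE avgE.
rewrite [X in `|X|](_ : _ = ((f m - (Phi m - Phi a) / ((ln b - ln a) / 2)) +
     (f m - (Phi m - Phi b) / - ((ln b - ln a) / 2))) / 2); last first.
  move: (lt0r_neq0 lab); set d := ln b - ln a => d0; by field.
apply: (le_trans (half_sum_bound Ba Bb)).
rewrite [in leRHS](_ : 3 - 1 / q = 1 + (2 - 1 / q)); last by ring.
have half (l p : R) : l / 2 * p = l * (1 / 2 * p) by ring.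
by rewrite powR_halfD1 half.
Qed.

Theorem theorem8 (R : realType) (I : set R) (f : R -> R) (a b q s : R)
    (I_itv : is_interval I) (I_pos : I `<=` `]0, +oo[)
    (f_diff : forall x : R, interior I x -> derivable f x 1)
    (aI : interior I a) (bI : interior I b) (ab : a < b)
    (f'_int : (@lebesgue_measure R).-integrable `[a, b] (EFin \o derive1 f))
    (q1 : 1 <= q) (s0 : 0 < s) (s1 : s <= 1) :
    (GA_s_convex_second s `[a, b] (fun x => `|derive1 f x| `^ q) ->
      `|(f a + f b) / 2 - log_average a b f| <=
        ln (b / a) * (1 / 2) `^ (2 - 1 / q) *
        (a * (c1 a b s q * `|derive1 f a| `^ q
              + c2 a b s q * `|derive1 f b| `^ q) `^ (1 / q)
         + b * (c3 a b s q * `|derive1 f b| `^ q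
              + c4 a b s q * `|derive1 f a| `^ q) `^ (1 / q))
      /\
      `|f (Num.sqrt (a * b)) - log_average a b f| <=
        ln (b / a) * (1 / 2) `^ (3 - 1 / q) *
        (a * (c1 a b s (q / 2) * `|derive1 f a| `^ q
              + c2 a b s (q / 2) * `|derive1 f (Num.sqrt (a * b))| `^ q) `^ (1 / q)
         + b * (c3 a b s (q / 2) * `|derive1 f b| `^ q
              + c4 a b s (q / 2) * `|derive1 f (Num.sqrt (a * b))| `^ q) `^ (1 / q)))
    /\
    (GA_s_convex_first s `[a, b] (fun x => `|derive1 f x| `^ q) ->
      `|(f a + f b) / 2 - log_average a b f| <=
        ln (b / a) * (1 / 2) `^ (2 - 1 / q) *
        (a * (c5 a b s q * `|derive1 f a| `^ q
              + c2 a b s q * `|derive1 f b| `^ q) `^ (1 / q)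
         + b * (c6 a b s q * `|derive1 f b| `^ q
              + c4 a b s q * `|derive1 f a| `^ q) `^ (1 / q))
      /\
      `|f (Num.sqrt (a * b)) - log_average a b f| <=
        ln (b / a) * (1 / 2) `^ (3 - 1 / q) *
        (a * (c5 a b s (q / 2) * `|derive1 f a| `^ q
              + c2 a b s (q / 2) * `|derive1 f (Num.sqrt (a * b))| `^ q) `^ (1 / q)
         + b * (c6 a b s (q / 2) * `|derive1 f b| `^ q
              + c4 a b s (q / 2) * `|derive1 f (Num.sqrt (a * b))| `^ q) `^ (1 / q))).

Proof.
have w20 (t : R) : 0 <= t <= 1 -> 0 <= `|t| `^ s by move=> _; exact: powR_ge0.
have cw2 := continuous_norm_powR s0.
have cw1 : continuous (fun t : R => `|1 - t| `^ s).
  move=> t.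
  apply: (@continuous_comp _ _ _ (fun t : R => 1 - t) (fun t => `|t| `^ s)).
    by apply: cvgB; [exact: cvg_cst|exact: cvg_id].
  exact: cw2.
have cw1' : continuous (fun t : R => 1 - `|t| `^ s).
  by move=> t; apply: cvgB; [exact: cvg_cst|exact: cw2].
have w10 (t : R) : 0 <= t <= 1 -> 0 <= `|1 - t| `^ s by move=> _; exact: powR_ge0.
have w10' (t : R) : 0 <= t <= 1 -> 0 <= 1 - `|t| `^ s.
  move=> /andP[t0 t1]; rewrite subr_ge0 ger0_norm//.
  have <- : (1 : R) `^ s = 1 by rewrite powR1.
  by apply: ge0_ler_powR; rewrite ?nnegrE ?(ltW s0).
have n2 (t : R) : 0 <= t <= 1 -> `|t| `^ s = t `^ s.
  by move=> /andP[t0 t1]; rewrite ger0_norm.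
have n1 (t : R) : 0 <= t <= 1 -> `|1 - t| `^ s = (1 - t) `^ s.
  by move=> /andP[t0 t1]; rewrite ger0_norm// subr_ge0.
have m2 r p : moment (fun t => `|t| `^ s) r p =
    \int[@lebesgue_measure R]_(t in `[0, 1]) (t `^ (s + 1) * r `^ (p * t)).
  apply: eq_Rintegral => t; rewrite inE/= in_itv/= => /andP[t0 t1].
  by rewrite ger0_norm// -[in RHS](mulr_powRB1 t0) ?addrK//; lra.
have m1 r p : moment (fun t => `|1 - t| `^ s) r p =
    \int[@lebesgue_measure R]_(t in `[0, 1]) (t * (1 - t) `^ s * r `^ (p * t)).
  exact: (eq_moment _ _ n1).
have m1' r p : moment (fun t => 1 - `|t| `^ s) r p =
    \int[@lebesgue_measure R]_(t in `[0, 1]) (t * (1 - t `^ s) * r `^ (p * t)).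
  by apply: (@eq_moment _ _ (fun t => 1 - t `^ s)) => t t01; rewrite n2.
split=> conv.
- have := @GA_weighted_bounds R I f _ _ a b q I_itv I_pos f_diff aI bI ab q1
    cw1 cw2 w10 w20.
  rewrite !m1 !m2; apply => x y t xab yab t01.
  by rewrite n1// n2//; exact: conv.
- have := @GA_weighted_bounds R I f _ _ a b q I_itv I_pos f_diff aI bI ab q1
    cw1' cw2 w10' w20.
  rewrite !m1' !m2; apply => x y t xab yab t01.
  by rewrite n2//; exact: conv.
Qed.
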